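(* There is a constant $C>0$ such that for every nonnegative integrable function $f:\mathbb{R}^2\to\mathbb{R}$ with $\operatorname{supp} f\subset\{x\in\mathbb{R}^2:|x|<1\}$ which has convex upper level sets and two (orthogonal) axes of symmetry, there holds $$C\,|f|_{\mathrm{TV}}\le\|Rf\|_{\mathrm{RTV}}.$$
   Context: The upper level sets of $f$ are the sets $\{x:f(x)>\alpha\}$. An axis of symmetry of $f$ is a line in $\mathbb{R}^2$ such that $f$ is invariant under reflection across it. The Radon transform in $\mathbb{R}^2$ is $Rf(\sigma,\theta)=\int_{x\cdot\theta=\sigma}f(x)\,dx$ (integration over lines), $(\sigma,\theta)\in\mathbb{R}\times S^1$. The total variation seminorm on $\mathbb{R}^n$ is $$|f|_{\mathrm{TV}}=\sup\left\{\int_{\mathbb{R}^n}f(x)\,\mathrm{div}\,\phi(x)\,dx:\ \phi\in[C_0^\infty(\mathbb{R}^n)]^n,\ |\phi(\cdot)|\le1\right\}.$$ For $g:\mathbb{R}\times S^{1}\to\mathbb{R}$, $\|g\|_{\mathrm{RTV}}=\sup_{\theta\in S^{1}}|g(\cdot,\theta)|_{\mathrm{TV}}$, where $|g(\cdot,\theta)|_{\mathrm{TV}}$ is the one-dimensional total variation with respect to $\sigma$. *)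

(* Defs.v *)
From HB Require Import structures.
From mathcomp Require Import all_boot all_order all_algebra.
From mathcomp Require Import all_classical all_reals all_analysis.
Set Implicit Arguments.
Unset Strict Implicit.
Unset Printing Implicit Defensive.
Import Order.TTheory GRing.Theory Num.Theory.
Import numFieldNormedType.Exports.
Local Open Scope classical_set_scope.
Local Open Scope ring_scope.

Section Plane.
Context {R : realType}.
Implicit Types x y p u theta : R * R.

Definition dot x y : R := x.1 * y.1 + x.2 * y.2.

(* The library norm on the product R * R is the max norm, hence this one. *)
Definition enorm x : R := Num.sqrt (dot x x).

Definition circle : set (R * R) := [set theta | enorm theta = 1].

(* Reflection across the line p + R u, for a unit vector u. *)
Definition reflection p u x : R * R :=
  p + (2 * dot (x - p) u) *: u - (x - p).

(* The line p + R u is an axis of symmetry of f. *)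
Definition symmetry_axis (f : R * R -> R) p u : Prop :=
  circle u /\ forall x, f (reflection p u x) = f x.

Definition leb2 :
    {measure set (measurableTypeR R * measurableTypeR R)%type -> \bar R} :=
  (@lebesgue_measure R \x @lebesgue_measure R)%E.

(* leb2 lives on the Borel sigma-algebra; a function is integrable for its
   completion iff it agrees a.e. with a Borel integrable function. On such
   functions the library integral against leb2, which is defined by suprema over
   simple functions, is still the Lebesgue integral. *)
Definition lebesgue_integrable2 (f : R * R -> R) : Prop :=
  exists2 g : R * R -> R,
    leb2.-integrable setT (EFin \o g) & {ae leb2, forall x, f x = g x}.

End Plane.

Section TotalVariation.
Context {R : realType}.

Definition iter_derive (V : normedModType R) (s : seq V) (f : V -> R) : V -> R :=
  foldr (fun v g => 'D_v g) f s.

(* C^oo: every iterated directional derivative is differentiable everywhere. *)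
Definition smooth (V : normedModType R) (f : V -> R) : Prop :=
  forall (s : seq V) (x : V), differentiable (iter_derive s f) x.

Definition supp (V : normedModType R) (f : V -> R) : set V :=
  closure [set x | f x != 0].

Definition test_function (V : normedModType R) (phi : V -> R) : Prop :=
  smooth phi /\ compact (supp phi).

Definition div2 (phi : R * R -> R * R) (x : R * R) : R :=
  'D_((1, 0) : R * R) (fun y => (phi y).1) x +
  'D_((0, 1) : R * R) (fun y => (phi y).2) x.

Definition tv2 (f : R * R -> R) : \bar R :=
  ereal_sup [set (\int[leb2]_x (f x * div2 phi x)%:E)%E | phi in
    [set phi : R * R -> R * R |
      [/\ test_function (fun x => (phi x).1),
          test_function (fun x => (phi x).2)
        & forall x, enorm (phi x) <= 1]]].

Definition tv1 (g : R -> R) : \bar R :=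
  ereal_sup [set (\int[lebesgue_measure]_x (g x * derive1 phi x)%:E)%E | phi in
    [set phi : R -> R | test_function phi /\ forall x, `|phi x| <= 1]].

End TotalVariation.

Section Radon.
Context {R : realType}.

(* The line x . theta = sigma is parametrized by arc length as
   t |-> sigma theta + t theta^perp. A non-integrable restriction gets
   the value 0, which for integrable f concerns a null set of sigma only. *)
Definition radon (f : R * R -> R) (sigma : R) (theta : R * R) : R :=
  \int[lebesgue_measure]_t
    f (sigma *: theta + t *: ((- theta.2, theta.1) : R * R)).

Definition rtv (g : R -> R * R -> R) : \bar R :=
  ereal_sup [set tv1 (fun sigma => g sigma theta) | theta in circle].

End Radon.

(* Main.v *)
Require Import Defs.
From mathcomp Require Import all_boot all_order all_algebra.
From mathcomp Require Import all_classical all_reals all_analysis.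
From mathcomp Require Import measurable_realfun ring lra.
Import Order.TTheory GRing.Theory Num.Theory.
Import numFieldNormedType.Exports.
Local Open Scope classical_set_scope.
Local Open Scope ring_scope.

(** The inequality holds with the constant 1/2.

    Let u, v be the orthonormal directions of the two axes.  In the basis
    (u, v) the divergence of a test field phi is D_u (phi . u) + D_v (phi . v),
    so it is enough to bound the integral of f * D_w psi, for w = u or v and
    |psi| <= 1, by the total variation of the Radon transform of f in the
    direction w.

    Fix w, and let s = s0 be the equation, in s = x . w, of the axis
    perpendicular to w.  On every line parallel to w, f is symmetric about
    s = s0 and has convex level sets, hence decreases with |s - s0|
    ([unimodal_of_convex_symmetric]).  Two consequences carry the proof.

    On the one hand, the Radon transform G of f in the direction w also
    decreases with |s - s0|.  Testing it against a smooth function that jumps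
    from -1 to 1 near s0 shows that 2 G(s) is at most the variation of G for
    all s different from s0 ([tv1_ge_peak], [line_integral_le_tv]).

    On the other hand, the integral of f * D_w psi is the limit for h -> 0 of
    (1/h) times the integral of f(x) (psi(x + h w) - psi(x)), which after a
    translation is the integral of (f(x - h w) - f(x)) psi(x).  As f
    decreases away from the axis, f(x - h w) - f(x) is nonnegative for
    s - s0 >= h/2 and nonpositive for s - s0 <= h/2, so psi can only be improved by
    replacing it by the sign of s - s0 - h/2.  Undoing the translation leaves
    twice the integral of f over the slab |s - s0| < h/2
    ([increment_le_tv]), that is 2 times the integral of G over an interval of
    length h, which is at most h times the variation of G
    ([slab_integral_le]).

    Since f is only equal almost everywhere to a Borel function g, integrals
    of f are replaced by integrals of g ([ae_eq_integral_any]), while pointwise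
    inequalities are always obtained from f. *)

Set Implicit Arguments.
Unset Strict Implicit.
Unset Printing Implicit Defensive.

(** * Integrals of arbitrary functions *)

Section IntegralWithoutMeasurability.
Context d (T : measurableType d) (R : realType).
Variable mu : {measure set T -> \bar R}.
Local Open Scope ereal_scope.
Import HBNNSimple.

(** The integral of a nonnegative function is a supremum over the simple
    functions below it, and truncating such a simple function on a null set
    does not change its integral; so almost everywhere comparison needs no
    measurability.  This matters because the level sets of [f] are convex but
    possibly not Borel, and because it spares any discussion of the
    measurability of the restrictions of [f] to lines. *)
Lemma ae_le_integral_any (F G : T -> \bar R) :
  (forall x, 0 <= F x) -> (forall x, 0 <= G x) ->
  {ae mu, forall x, F x <= G x} ->
  \int[mu]_x F x <= \int[mu]_x G x.
Proof.
move=> F0 G0 [N [mN N0 FGN]].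
rewrite !ge0_integralTE//; apply: ge_ereal_sup => _ [h /= hF <-].
have mNC : measurable (~` N) by exact: measurableC.
pose k : {nnsfun T >-> R} := mul_nnsfun h (indic_nnsfun R mNC).
have kE x : k x = (h x * \1_(~` N) x)%R by [].
have kG x : (k x)%:E <= G x.
  rewrite kE indicE; have [xN|xN] := boolP (x \in ~` N); last by rewrite mulr0.
  rewrite mulr1; apply: le_trans (hF x) _; apply: contrapT => FG.
  by move: xN; rewrite inE; apply; exact: FGN.
apply: (@le_trans _ _ (sintegral mu k)); last first.
  by apply: ereal_sup_ubound; exists k.
rewrite -!integralT_nnsfun.
apply: ae_ge0_le_integral => //.
- by move=> x _; rewrite lee_fin.
- by apply/measurable_EFinP; exact: measurable_funP.
- by move=> x _; rewrite lee_fin.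
- by apply/measurable_EFinP; exact: measurable_funP.
exists N; split => // x /= xP; apply: contrapT => xN; apply: xP => _.
by have := kE x; rewrite indicE mem_set// mulr1 /= => ->.
Qed.

Lemma ae_eq_integral_any (F G : T -> \bar R) :
  {ae mu, forall x, F x = G x} -> \int[mu]_x F x = \int[mu]_x G x.
Proof.
move=> FG; rewrite integralE [RHS]integralE.
by congr (_ - _); apply/eqP; rewrite eq_le; apply/andP; split;
  apply: ae_le_integral_any => // ;
  apply: filterS FG => x FGx; rewrite !(funeposE, funenegE) FGx.
Qed.

End IntegralWithoutMeasurability.

(** * A smooth step function *)

Section SmoothFunctionsOfOneVariable.
Context {R : realType}.
Implicit Types f g : R -> R.

(** A recursive form of n-fold differentiability, so that stability under the
    field operations and affine substitutions follows by induction from the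
    rules for one derivative. *)
Fixpoint Cn (n : nat) f : Prop :=
  if n is m.+1 then (forall x, derivable f x 1) /\ Cn m (derive1 f) else True.

Lemma CnW n f : Cn n.+1 f -> Cn n f.
Proof.
elim: n f => [//|n IH] f [df Cdf]; split => //.
exact: IH Cdf.
Qed.

Lemma CnD n f g : Cn n f -> Cn n g -> Cn n (f \+ g).
Proof.
elim: n f g => [//|n IH] f g [df Cf] [dg Cg]; split.
  by move=> x; exact: derivableD.
rewrite (_ : derive1 _ = derive1 f \+ derive1 g); first exact: IH.
by apply/funext => x; rewrite /= !derive1E deriveD.
Qed.

Lemma CnM n f g : Cn n f -> Cn n g -> Cn n (f \* g).
Proof.
elim: n f g => [//|n IH] f g Cf' Cg'.
have [df Cf] := Cf'; have [dg Cg] := Cg'; split.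
  by move=> x; exact: derivableM.
rewrite (_ : derive1 _ = (f \* derive1 g) \+ (g \* derive1 f)).
  by apply: CnD; apply: IH => //; exact: CnW.
by apply/funext => x; rewrite /= !derive1E deriveM.
Qed.

Lemma Cn_cst n (c : R) : Cn n (fun=> c).
Proof.
elim: n c => [//|n IH] c; split; first by move=> x; exact: derivable_cst.
by rewrite (_ : derive1 _ = fun=> 0)//; apply/funext => x; rewrite derive1_cst.
Qed.

Lemma CnV n f : (forall x, f x != 0) -> Cn n f -> Cn n (fun x => (f x)^-1).
Proof.
move=> f0; elim: n => [//|n IH] Cf'; have [df Cf] := Cf'; split.
  by move=> x; exact: derivableV.
rewrite (_ : derive1 _ = (fun=> -1) \*
    ((fun x => (f x)^-1) \* (fun x => (f x)^-1)) \* derive1 f).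
  by apply: CnM => //; apply: CnM; [exact: Cn_cst|apply: CnM; apply/IH/CnW].
apply/funext => x /=; rewrite !derive1E deriveV//= -!derive1E /GRing.scale/=.
by field.
Qed.

Lemma Cn_affine n f (a b : R) : Cn n f -> Cn n (fun x => f (a * x + b)).
Proof.
elim: n f => [//|n IH] f [df Cf].
have dfa (x : R) : is_derive x 1 (fun x => f (a * x + b)) (a * derive1 f (a * x + b)).
  have : is_derive x 1 (fun x => a * x + b) a.
    by apply: is_derive_eq; rewrite /GRing.scale/=; ring.
  move=> dab; have dfx : is_derive (a * x + b) 1 f (derive1 f (a * x + b)).
    by rewrite derive1E; exact/derivableP.
  by have := @is_derive1_comp _ f (fun x => a * x + b) x _ _ dfx dab; rewrite mulrC.
split; first by move=> x; case: (dfa x).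
rewrite (_ : derive1 _ = (fun=> a) \* (fun x => derive1 f (a * x + b))).
  by apply: CnM; [exact: Cn_cst|exact: IH].
by apply/funext => x /=; rewrite derive1E; apply: derive_val.
Qed.

(** On the line a derivative in the direction [v] is [v] times the ordinary
    derivative, so iterated directional derivatives stay in the family. *)
Lemma smooth_Cn f : (forall n, Cn n f) -> smooth f.
Proof.
move=> Cf s; suff Cs n : Cn n (iter_derive s f).
  by move=> x; apply/derivable1_diffP; have [+ _] := Cs 1; exact.
elim: s n => [//|v s IH] n /=.
rewrite (_ : (fun _ => _) = (fun=> v) \* derive1 (iter_derive s f)).
  by apply: CnM; [exact: Cn_cst|have [] := IH n.+1].
apply/funext => x /=; have [/(_ x)/derivable1_diffP dx _] := IH 1.
by rewrite derive1E !deriveE// -[v in LHS]mulr1 -[v * 1]/(v *: 1) linearZ.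
Qed.

Lemma poly_expRN_bounded (Q : {poly R}) :
  exists2 C : R, 0 <= C & forall y, 0 <= y -> `|Q.[y]| * expR (- y) <= C.
Proof.
exists (\sum_(i < size Q) `|Q`_i| * (i`!)%:R).
  by apply: sumr_ge0 => i _; rewrite mulr_ge0.
move=> y y0; rewrite horner_coef.
apply: (@le_trans _ _ ((\sum_(i < size Q) `|Q`_i * y ^+ i|) * expR (- y))).
  by rewrite ler_wpM2r ?expR_ge0// ler_norm_sum.
rewrite mulr_suml ler_sum// => i _.
rewrite normrM -mulrA ler_wpM2l// ger0_norm ?exprn_ge0//.
rewrite expRN ler_pdivrMr ?expR_gt0//.
case: (nat_of_ord i) => [|k].
  by rewrite expr0 fact0 mul1r -expR0 ler_expR.
rewrite mulrC -ler_pdivrMr ?ltr0n ?fact_gt0//.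
by apply: le_trans (expR_ge1Dxn k y0); rewrite lerDr.
Qed.

(** The functions [P(1/x) exp(-1/x)], extended by 0 to [x <= 0], form a family
    closed under derivation; [flat 1] is the usual flat function. *)
Definition flat (P : {poly R}) (x : R) : R :=
  if 0 < x then P.[x^-1] * expR (- x^-1) else 0.

(** At the origin, [y ^+ 2 * P.[y] * exp (- y)] is bounded for [y = 1/x], so
    that [flat P] is O(x^2) there and has derivative 0. *)
Lemma is_derive_flat P (x : R) :
  is_derive x 1 (flat P) (flat ('X^2 * (P - P^`())) x).
Proof.
have [x0|x0|->] := ltgtP x 0.
- apply: (@near_eq_is_derive _ _ _ (cst 0)).
    near=> y; rewrite /flat /= ifF//; apply/negbTE; rewrite -leNgt ltW//.
    near: y; exact: lt_nbhsl.
  by rewrite /flat ltNge (ltW x0)/=; exact: is_derive_cst.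
- rewrite {2}/flat x0; have xn0 : x != 0 by rewrite gt_eqF.
  have dV : is_derive x 1 (fun y : R => y^-1) (- x ^- 2).
    apply: DeriveDef; first exact: derivableV.
    by rewrite deriveV// derive_id /GRing.scale/= mulr1.
  have dP : is_derive x 1 (fun y : R => P.[y^-1]) (P^`().[x^-1] * - x ^- 2).
    by apply: (@is_derive1_comp _ (horner P) (fun y : R => y^-1)).
  have dE : is_derive x 1 (fun y : R => expR (- y^-1)) (expR (- x^-1) * x ^- 2).
    have dN : is_derive x 1 (fun y : R => - y^-1) (x ^- 2).
      by rewrite -[x ^- 2]opprK; apply: is_deriveN.
    by apply: (@is_derive1_comp _ expR (fun y : R => - y^-1)).
  have dPE := is_deriveM dP dE.
  have nE : \forall y \near x, 
      ((fun y : R => P.[y^-1]) * (fun y : R => expR (- y^-1))) y = flat P y.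
    near=> y; rewrite /flat /= ifT//; near: y; exact: lt_nbhsr.
  have [? dval] := near_eq_is_derive nE dPE.
  apply: DeriveDef => //; rewrite dval.
  rewrite /GRing.scale/= hornerM hornerXn hornerD hornerN. by field.
- have [C C0 CP] := poly_expRN_bounded ('X^2 * P).
  have flat_le h : `|flat P h| <= C * h ^+ 2.
    rewrite /flat; case: ifPn => h0; last by rewrite normr0 mulr_ge0// sqr_ge0.
    have := CP h^-1; rewrite invr_ge0 (ltW h0) => /(_ isT).
    rewrite hornerM hornerXn normrM (ger0_norm (sqr_ge0 _)) => PC.
    rewrite normrM (ger0_norm (expR_ge0 _)) -ler_pdivrMr ?exprn_gt0//.
    apply: le_trans PC; rewrite exprVn le_eqVlt; apply/orP; left; apply/eqP.
    by ring.
  rewrite [X in is_derive _ _ _ X](_ : _ = 0); last by rewrite /flat ltxx.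
  have f00 : flat P 0 = 0 by rewrite /flat ltxx.
  have cv : h^-1 *: ((flat P \o shift 0) (h *: 1) - flat P 0) @[h --> 0^'] --> (0 : R).
    apply/cvgrPdist_le => /= e e0; near=> h.
    rewrite /shift/= addr0 f00 subr0 sub0r normrN /GRing.scale/= mulr1 normrM normfV.
    have hn0 : 0 < `|h| by rewrite normr_gt0; near: h; exact: nbhs_dnbhs_neq.
    rewrite mulrC ler_pdivrMr//.
    apply: le_trans (flat_le h) _.
    rewrite -(real_normK (num_real h)) expr2 mulrA ler_wpM2r// ltW//.
    apply: (@le_lt_trans _ _ ((C + 1) * `|h|)); first by rewrite ler_wpM2r// lerDl.
    rewrite mulrC -ltr_pdivlMr; last by rewrite ltr_wpDl.
    near: h; apply: dnbhs0_lt; by rewrite divr_gt0// ltr_wpDl.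
  by apply: DeriveDef; [apply/cvg_ex; exists 0|exact/cvg_lim].
Unshelve. all: by end_near. Qed.

Lemma Cn_flat n P : Cn n (flat P).
Proof.
elim: n P => [//|n IH] P; split.
  by move=> x; case: (is_derive_flat P x).
rewrite (_ : derive1 _ = flat ('X^2 * (P - P^`())))//.
apply/funext => x; rewrite derive1E.
by have := is_derive_flat P x => ?; exact: derive_val.
Qed.

Let h := flat 1.

Lemma flat1_ge0 x : 0 <= h x.
Proof. by rewrite /h /flat; case: ifPn => // _; rewrite hornerE mul1r expR_ge0. Qed.

Lemma flat1_gt0 x : 0 < x -> 0 < h x.
Proof. by move=> x0; rewrite /h /flat x0 hornerE mul1r expR_gt0. Qed.

Lemma flat1_le0 x : x <= 0 -> h x = 0.
Proof. by move=> x0; rewrite /h /flat ltNge x0. Qed.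

Lemma flat1_sum_gt0 x : 0 < h x + h (1 - x).
Proof.
have [x0|x0] := ltP 0 x; first by rewrite ltr_pwDl ?flat1_ge0 ?flat1_gt0.
by rewrite ltr_wpDl ?flat1_ge0// flat1_gt0// subr_gt0 (le_lt_trans x0).
Qed.

(** The denominator never vanishes: one of [x], [1 - x] is positive. *)
Definition step x := h x / (h x + h (1 - x)).

Lemma Cn_step n : Cn n step.
Proof.
rewrite (_ : step = h \* (fun x => ((h \+ (fun x => h (-1 * x + 1))) x)^-1)).
  apply: CnM; first exact: Cn_flat.
  apply: CnV; first by move=> x /=; rewrite mulN1r (addrC (- x)) gt_eqF// flat1_sum_gt0.
  by apply: CnD; [|apply: Cn_affine]; exact: Cn_flat.
by apply/funext => x /=; rewrite /step mulN1r (addrC (- x)).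
Qed.

Lemma step_ge0 x : 0 <= step x.
Proof. by rewrite divr_ge0 ?flat1_ge0// ltW// flat1_sum_gt0. Qed.

Lemma step_le1 x : step x <= 1.
Proof. by rewrite ler_pdivrMr ?flat1_sum_gt0// mul1r lerDl flat1_ge0. Qed.

Lemma step_le0 x : x <= 0 -> step x = 0.
Proof. by move=> x0; rewrite /step flat1_le0// mul0r. Qed.

Lemma step_ge1 x : 1 <= x -> step x = 1.
Proof.
move=> x1; rewrite /step (@flat1_le0 (1 - x)) ?subr_le0// addr0 divff//.
by rewrite gt_eqF// flat1_gt0// (lt_le_trans ltr01).
Qed.

Lemma flat1_nd : {homo h : x y / x <= y}.
Proof.
move=> x y xy; have [x0|x0] := leP x 0; first by rewrite flat1_le0// flat1_ge0.
have y0 := lt_le_trans x0 xy.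
by rewrite /h /flat x0 y0 !hornerE ?mul1r ler_expR lerN2 lef_pV2.
Qed.

Lemma step_nd : {homo step : x y / x <= y}.
Proof.
move=> x y xy; rewrite /step ler_pdivrMr ?flat1_sum_gt0//.
rewrite mulrAC ler_pdivlMr ?flat1_sum_gt0// !mulrDr mulrC lerD2l.
by rewrite ler_pM ?flat1_ge0 ?flat1_nd// lerD2l lerN2.
Qed.

Lemma derive1_nd_ge0 f x : derivable f x 1 -> {homo f : x y / x <= y} ->
  0 <= derive1 f x.
Proof.
move=> df fnd; rewrite derive1E; apply: limr_ge; first exact: df.
near=> k.
have k0 : k != 0 by near: k; exact: nbhs_dnbhs_neq.
rewrite /GRing.scale/= mulr1.
have [k1|k1|/eqP] := ltgtP k 0; last by rewrite (negbTE k0).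
  rewrite nmulr_rge0 ?invr_lt0// subr_le0 fnd// /shift/= gerDr; exact: ltW.
rewrite pmulr_rge0 ?invr_gt0// subr_ge0 fnd// /shift/= lerDr; exact: ltW.
Unshelve. all: by end_near. Qed.

End SmoothFunctionsOfOneVariable.

(** * Total variation of a peak *)

Section TotalVariationOfUnimodalFunction.
Context {R : realType}.
Local Notation mu := (@lebesgue_measure R).

(** If [G] is at least [k] on the punctured interval of radius [s] around [c],
    test it against a function [phi] that rises smoothly from -1 to 1 on this
    interval and returns to 0 only outside the support of [G].  Then
    [G * phi'] is nonnegative everywhere, and its integral over the interval
    is at least [k * (1 - (-1))], the point [c], where [G] may be small, being
    negligible. *)
Lemma tv1_ge_peak (G : R -> R) (c s M k : R) : 0 < s -> 0 <= k ->
  (forall x : R, 0 <= G x) ->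
  (forall x : R, x != c -> `|x - c| <= s -> k <= G x) ->
  (forall x : R, M <= `|x - c| -> G x = 0) ->
  ((2 * k)%:E <= tv1 G)%E.
Proof.
move=> s0 k0 G0 Gk GM.
have [B MB sB] : exists2 B : R, M < B & s < B.
  exists (`|M| + s + 1); last by rewrite addrAC ltrDr ltr_wpDl.
  by rewrite (le_lt_trans (ler_norm M))// -addrA ltrDl addr_gt0.
pose psi (x : R) := 2 * step ((2 * s)^-1 * x + (s - c) / (2 * s)) - 1.
pose phi (x : R) := 2 * step ((2 * s)^-1 * x + (s - c) / (2 * s)) -
  step (1 * x + (- c - B)) - step (1 * x + (B + 1 - c)).
have affE (x : R) : (2 * s)^-1 * x + (s - c) / (2 * s) = (x - c + s) / (2 * s).
  by field; rewrite gt_eqF.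
have Cpsi n : Cn n psi.
  apply: (@CnD _ n (fun x => 2 * step ((2 * s)^-1 * x + (s - c) / (2 * s)))
    (fun=> -1)); last exact: Cn_cst.
  apply: (@CnM _ n (fun=> 2)); first exact: Cn_cst.
  exact/Cn_affine/Cn_step.
have Cphi n : Cn n phi.
  have CN a b : Cn n (fun x => - step (a * x + b)).
    rewrite (_ : (fun _ => _) = (fun=> -1) \* (fun x => step (a * x + b))).
      by apply: CnM; [exact: Cn_cst|exact/Cn_affine/Cn_step].
    by apply/funext => x /=; rewrite mulN1r.
  apply: (@CnD _ n (fun x => 2 * step ((2 * s)^-1 * x + (s - c) / (2 * s)) -
    step (1 * x + (- c - B)))); last exact: CN.
  apply: (@CnD _ n (fun x => 2 * step ((2 * s)^-1 * x + (s - c) / (2 * s))));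
    last exact: CN.
  apply: (@CnM _ n (fun=> 2)); first exact: Cn_cst.
  exact/Cn_affine/Cn_step.
have phi_psi (x : R) : `|x - c| < B -> phi x = psi x.
  rewrite ltr_norml => /andP[xl xr]; rewrite /phi /psi mul1r.
  rewrite (@step_le0 _ (x + (- c - B))); last by lra.
  by rewrite (@step_ge1 _ (x + (B + 1 - c))) ?subr0//; lra.
have psiL (x : R) : x - c <= - s -> psi x = -1.
  move=> xs; rewrite /psi affE step_le0 ?mulr0 ?sub0r//.
  by rewrite pmulr_lle0 ?invr_gt0 ?mulr_gt0//; lra.
have psiR (x : R) : s <= x - c -> psi x = 1.
  move=> xs; rewrite /psi affE step_ge1; first by lra.
  by rewrite ler_pdivlMr ?mulr_gt0//; lra.
have phiL (x : R) : x - c <= - s -> phi x = - step (1 * x + (B + 1 - c)).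
  move=> xs; rewrite /phi affE (@step_le0 _ (_ / _)); last first.
    by rewrite pmulr_lle0 ?invr_gt0 ?mulr_gt0//; lra.
  by rewrite (@step_le0 _ (1 * x + (- c - B))); lra.
have phiR (x : R) : s <= x - c -> phi x = 1 - step (1 * x + (- c - B)).
  move=> xs; rewrite /phi affE (@step_ge1 _ (_ / _)); last first.
    by rewrite ler_pdivlMr ?mulr_gt0//; lra.
  by rewrite (@step_ge1 _ (1 * x + (B + 1 - c))); lra.
have phi_out (x : R) : B + 1 <= `|x - c| -> phi x = 0.
  have [xc|xc] := leP 0 (x - c).
    by rewrite (ger0_norm xc) => h; rewrite phiR ?step_ge1; lra.
  by rewrite (ltr0_norm xc) => h; rewrite phiL ?step_le0; lra.
have phi_le1 (x : R) : `|phi x| <= 1.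
  have [xs|xs] := leP (x - c) (- s).
    rewrite phiL// normrN ger0_norm ?step_ge0//; exact: step_le1.
  have [xs'|xs'] := leP s (x - c).
    rewrite phiR// ger0_norm ?subr_ge0 ?step_le1//.
    by rewrite gerBl step_ge0.
  rewrite phi_psi; last by rewrite ltr_norml; apply/andP; split; lra.
  rewrite /psi; set y := (X in step X); have := step_ge0 y; have := step_le1 y.
  by move=> *; rewrite ler_norml; apply/andP; split; lra.
have phi_test : test_function phi.
  split; first exact: smooth_Cn.
  apply: (@subclosed_compact _ _ `[c - (B + 1), c + (B + 1)]);
    [exact: closed_closure|exact: segment_compact|].
  have cI : closed (`[c - (B + 1), c + (B + 1)]%classic : set R) by exact: itv_closed.
  rewrite [X in _ `<=` X](closure_id _).1//.
  apply: closure_subset => x /= phix.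
  rewrite in_itv/=; have : `|x - c| < B + 1.
    by rewrite ltNge; apply/negP => /phi_out /eqP; rewrite (negbTE phix).
  by rewrite ltr_norml => /andP[? ?]; apply/andP; split; lra.
have dphi (x : R) : derivable phi x 1 by have [+ _] := Cphi 1; exact.
have dpsi (x : R) : derivable psi x 1 by have [+ _] := Cpsi 1; exact.
have ddphi (x : R) : derivable (derive1 phi) x 1 by have [_ [+ _]] := Cphi 2; exact.
have psi_nd : {homo psi : x y / x <= y}.
  move=> x y xy; rewrite /psi lerD2r ler_pM2l// step_nd// lerD2r ler_pM2l//.
  by rewrite invr_gt0 mulr_gt0.
have dphi_ge0 (x : R) : `|x - c| < B -> 0 <= derive1 phi x.
  move=> xB; rewrite (_ : derive1 phi x = derive1 psi x); first exact: derive1_nd_ge0.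
  rewrite !derive1E; apply: near_eq_derive.
  near=> y; apply: phi_psi; near: y.
  have cN : (fun y => `|y - c|) @ x --> `|x - c|.
    by apply: cvg_norm; apply: cvgB; [exact: cvg_id|exact: cvg_cst].
  exact: (cvgr_lt _ cN).
have Gphi_ge0 (x : R) : 0 <= G x * derive1 phi x.
  have [xB|xB] := ltP `|x - c| B; first by rewrite mulr_ge0// dphi_ge0.
  by rewrite GM ?mul0r// (le_trans (ltW MB)).
pose I := `[c - s, c + s]%classic : set R.
apply: (@le_trans _ _ (\int[mu]_x (G x * derive1 phi x)%:E)%E); last first.
  by apply: ereal_sup_ubound; exists phi.
have phiE1 : phi (c + s) = 1.
  by rewrite phi_psi ?psiR//; [lra|rewrite ltr_norml; apply/andP; split; lra].
have phiE2 : phi (c - s) = -1.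
  by rewrite phi_psi ?psiL//; [lra|rewrite ltr_norml; apply/andP; split; lra].
have intE : (\int[mu]_x (((fun x => (k * derive1 phi x)%:E) \_ I) x))%E = (2 * k)%:E.
  rewrite -integral_mkcond.
  have -> := @continuous_FTC2 R (fun x => k * derive1 phi x) (fun x => k * phi x)
    (c - s) (c + s).
  - by rewrite phiE1 phiE2 -EFinB; congr (_%:E); ring.
  - by lra.
  - apply: continuous_subspaceT => x.
    apply: cvgM; first exact: cvg_cst.
    exact/differentiable_continuous/derivable1_diffP.
  - have ck (x : R) : {for x, continuous (fun x => k * phi x)}.
      apply: cvgM; first exact: cvg_cst.
      exact/differentiable_continuous/derivable1_diffP.
    split.
    + by move=> x _; apply: (@derivableM _ _ (cst k) phi); [exact: derivable_cst|exact: dphi].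
    + by apply: cvg_at_right_filter; exact: ck.
    + by apply: cvg_at_left_filter; exact: ck.
  - move=> x _; rewrite !derive1E (@deriveM _ _ (cst k) phi)//=.
    by rewrite derive_cst /GRing.scale/= mulr0 addr0.
rewrite -intE; apply: ae_le_integral_any.
- move=> x; rewrite patchE; case: ifPn => // /[1!inE].
  rewrite /I /= in_itv/= => /andP[x1 x2].
  rewrite lee_fin mulr_ge0// dphi_ge0// ltr_norml; apply/andP; split; lra.
- by move=> x; rewrite lee_fin.
exists [set c]; split => //; first exact: lebesgue_measure_set1.
move=> x /= xP; apply: contrapT => xc; apply: xP.
rewrite patchE; case: ifPn => [|_]; last by rewrite lee_fin.
rewrite inE /I /= in_itv/= => /andP[x1 x2].
rewrite lee_fin ler_wpM2r// ?dphi_ge0// ?Gk//.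
- by rewrite ltr_norml; apply/andP; split; lra.
- exact/eqP.
- by rewrite ler_norml; apply/andP; split; lra.
Unshelve. all: by end_near. Qed.

End TotalVariationOfUnimodalFunction.

(** * Measure preserving maps of the plane *)

Section MeasurePreservingMaps.
Context {R : realType}.
Local Notation mu := (@lebesgue_measure R).
Local Notation PR := (measurableTypeR R * measurableTypeR R)%type.

Lemma lebesgue_measure_shift (a : R) (A : set (measurableTypeR R)) :
  measurable A -> mu ((fun x => x + a) @^-1` A) = mu A.
Proof.
have mf : measurable_fun setT (fun x : measurableTypeR R => x + a : measurableTypeR R).
  exact: measurable_funD.
move=> mA; apply/esym.
rewrite -[RHS]/(pushforward mu (fun x : measurableTypeR R => x + a : measurableTypeR R) A).
apply: lebesgue_measure_unique => // _ [[x y] _ <-].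
transitivity (mu `]x - a, y - a]%classic); last first.
  congr (mu _); apply/seteqP; split => z /=; by rewrite !in_itv/= ltrBlDr lerBrDr.
rewrite !lebesgue_measure_itv/= !lte_fin ltrD2r; case: ifPn => // _.
by rewrite -!EFinB; congr (_%:E); ring.
Qed.

Definition measure_preserving (T : PR -> PR) :=
  measurable_fun setT T /\
  forall A, measurable A -> leb2 (T @^-1` A) = leb2 A.

Lemma measure_preserving_comp (S T : PR -> PR) :
  measure_preserving S -> measure_preserving T -> measure_preserving (S \o T).
Proof.
move=> [mS pS] [mT pT]; split; first exact: measurableT_comp.
move=> A mA; rewrite comp_preimage pT ?pS//.
by rewrite -[X in measurable X]setTI; exact: mS.
Qed.

Lemma measure_preserving_rectangles (T : PR -> PR) : measurable_fun setT T ->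
  (forall A B : set (measurableTypeR R), measurable A -> measurable B ->
    leb2 (T @^-1` (A `*` B)) = (mu A * mu B)%E) ->
  measure_preserving T.
Proof.
move=> mT TE; split => // A mA.
rewrite -[LHS]/(pushforward leb2 T A).
by apply/esym; apply: product_measure_unique.
Qed.

(** Each horizontal section of the preimage of a rectangle is a translate of a
    section of the rectangle, hence has the same length. *)
Lemma measure_preserving_shear1 (k : R) :
  measure_preserving (fun z => (z.1 + k * z.2, z.2)).
Proof.
have mT : measurable_fun setT (fun z : PR => (z.1 + k * z.2, z.2) : PR).
  apply/measurable_fun_pairP; split => /=; last exact: measurable_snd.
  by apply: measurable_funD; [exact: measurable_fst|
    apply: measurable_funM => //; exact: measurable_snd].
apply: measure_preserving_rectangles => // A B mA mB.
have mTA : measurable ((fun z : PR => (z.1 + k * z.2, z.2) : PR) @^-1` (A `*` B)).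
  by rewrite -[X in measurable X]setTI; apply: mT => //; exact: measurableX.
transitivity ((mu \x^ mu)%E ((fun z : PR => (z.1 + k * z.2, z.2) : PR) @^-1` (A `*` B))).
  apply: product_measure_unique => // A' B' mA' mB'.
  exact: (@product_measure2E _ _ _ _ R mu mu).
rewrite /product_measure2 /=.
rewrite (eq_integral (fun y => (mu A * (\1_B y)%:E)%E)); last first.
  move=> y _ /=; rewrite indicE.
  have [yB|yB] := boolP (y \in B).
    rewrite mule1 -(@lebesgue_measure_shift (k * y) A)//; congr (mu _).
    apply/seteqP; split => x; rewrite /ysection /= inE /=; first by case.
    by move=> ?; split => //; exact: set_mem.
  rewrite mule0; rewrite (_ : ysection _ _ = set0) ?measure0//.
  apply/seteqP; split => // x; rewrite /ysection /= inE /= => -[_].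
  by move/mem_set; rewrite (negbTE yB).
rewrite ge0_integralZl//; last by exact: measurableT_comp.
by rewrite integral_indic ?setIT.
Qed.

Lemma measure_preserving_shear2 (k : R) :
  measure_preserving (fun z => (z.1, z.2 + k * z.1)).
Proof.
have mT : measurable_fun setT (fun z : PR => (z.1, z.2 + k * z.1) : PR).
  apply/measurable_fun_pairP; split => /=; first exact: measurable_fst.
  by apply: measurable_funD; [exact: measurable_snd|
    apply: measurable_funM => //; exact: measurable_fst].
apply: measure_preserving_rectangles => // A B mA mB.
rewrite -[LHS]/((mu \x mu)%E ((fun z : PR => (z.1, z.2 + k * z.1) : PR) @^-1` (A `*` B))).
rewrite /product_measure1 /=.
rewrite (eq_integral (fun x => ((\1_A x)%:E * mu B)%E)); last first.
  move=> x _ /=; rewrite indicE.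
  have [xA|xA] := boolP (x \in A).
    rewrite mul1e -(@lebesgue_measure_shift (k * x) B)//; congr (mu _).
    apply/seteqP; split => y; rewrite /xsection /= inE /=; first by case.
    by move=> ?; split => //; exact: set_mem.
  rewrite mul0e; rewrite (_ : xsection _ _ = set0) ?measure0//.
  apply/seteqP; split => // y; rewrite /xsection /= inE /= => -[+ _].
  by move/mem_set; rewrite (negbTE xA).
rewrite ge0_integralZr//; last by exact: measurableT_comp.
by rewrite integral_indic ?setIT.
Qed.

Lemma measure_preserving_translation (a : PR) :
  measure_preserving (fun z => (z.1 + a.1, z.2 + a.2)).
Proof.
apply: measure_preserving_rectangles => [|A B mA mB].
  by apply/measurable_fun_pairP; split => /=; exact: measurable_funD.
rewrite -(@lebesgue_measure_shift a.1 A)// -(@lebesgue_measure_shift a.2 B)//.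
rewrite -product_measure1E//;
  by rewrite -[X in measurable X]setTI; apply: measurable_funD.
Qed.

Lemma ge0_integral_measure_preserving (T : PR -> PR) (F : PR -> \bar R) :
  measure_preserving T -> measurable_fun setT F -> (forall z, (0 <= F z)%E) ->
  (\int[leb2]_z F (T z) = \int[leb2]_z F z)%E.
Proof.
move=> [mT pT] mF F0.
have e := @ge0_integral_pushforward _ _ _ _ R T mT leb2 setT F measurableT mF
  (fun y _ => F0 y).
have eT : T @^-1` setT = setT by [].
rewrite eT in e; apply: (etrans (esym e)).
by apply: eq_measure_integral => A mA _; exact: pT.
Qed.

Lemma integral_measure_preserving (T : PR -> PR) (F : PR -> \bar R) :
  measure_preserving T -> measurable_fun setT F ->
  (\int[leb2]_z F (T z) = \int[leb2]_z F z)%E.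
Proof.
move=> pT mF; rewrite integralE [RHS]integralE; congr (_ - _)%E.
  rewrite -(ge0_integral_measure_preserving pT (measurable_funepos mF))//.
  by apply: eq_integral => z _; rewrite !funeposE.
rewrite -(ge0_integral_measure_preserving pT (measurable_funeneg mF))//.
by apply: eq_integral => z _; rewrite !funenegE.
Qed.

Lemma integrable_measure_preserving (T : PR -> PR) (F : PR -> R) :
  measure_preserving T -> leb2.-integrable setT (EFin \o F) ->
  leb2.-integrable setT (EFin \o (F \o T)).
Proof.
move=> pT /integrableP[mF iF]; apply/integrableP; split.
  by apply: (measurableT_comp mF); case: pT.
apply: le_lt_trans iF; rewrite le_eqVlt; apply/orP; left; apply/eqP.
apply: (ge0_integral_measure_preserving pT (F := fun z => `|(F z)%:E|%E)) => //.
by apply: measurableT_comp.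
Qed.

Lemma ae_measure_preserving (T : PR -> PR) (P : PR -> Prop) :
  measure_preserving T -> {ae leb2, forall z, P z} ->
  {ae leb2, forall z, P (T z)}.
Proof.
move=> [mT pT] [N [mN N0 PN]].
exists (T @^-1` N); split; first by rewrite -[X in measurable X]setTI; exact: mT.
  by rewrite /= pT.
by move=> z /= Pz; exact: PN.
Qed.

End MeasurePreservingMaps.

(** * Test functions on the plane *)

Section BorelPlane.
Context {R : realType}.
Local Notation PR := (measurableTypeR R * measurableTypeR R)%type.

(** An open set is the union of the squares with rational centre and radius
    [1 / n.+1] which it contains. *)
Lemma open_measurable_plane (U : set (R * R)) : open U -> measurable (U : set PR).
Proof.
move=> oU.
pose box (p q : rat) (n : nat) : set PR :=
  (ball (ratr p : R) n.+1%:R^-1 : set (measurableTypeR R)) `*`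
  (ball (ratr q : R) n.+1%:R^-1 : set (measurableTypeR R)).
have mbox p q n : measurable (box p q n).
  by apply: measurableX; apply: open_measurable; exact: ball_open.
pose box' p q n := if `[< box p q n `<=` U >] then box p q n else set0.
have -> : (U : set PR) = \bigcup_p \bigcup_q \bigcup_n box' p q n.
  apply/seteqP; split => [[x y] Uxy|[x y] [p _ [q _ [n _]]]]; last first.
    by rewrite /box'; case: ifPn => // /asboolP bU /bU.
  have : nbhs ((x, y) : R * R) U by exact: open_nbhs_nbhs.
  move=> /nbhs_ballP[e /= e0 eU].
  have [n ne] : exists n : nat, n.+1%:R^-1 < e / 2 :> R.
    have e2 : 0 < e / 2 by rewrite divr_gt0.
    have [N _ NP] := near_infty_natSinv_lt (PosNum e2).
    by exists N; exact: (NP N (leqnn N)).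
  have n0 : 0 < n.+1%:R^-1 :> R by rewrite invr_gt0 ltr0n.
  have rat_near (z d : R) : 0 < d -> exists p : rat, `|ratr p - z| < d.
    move=> d0; have /rat_in_itvoo[p] : z - d < z + d by lra.
    rewrite in_itv/= => /andP[p1 p2]; exists p.
    by rewrite ltr_norml; apply/andP; split; lra.
  have ball_trans (a b c d : R) :
      `|b - a| < d -> d < e / 2 -> `|b - c| < d -> `|a - c| < e.
    move=> ab de bc; rewrite (_ : a - c = (b - c) - (b - a)); last by ring.
    by rewrite (le_lt_trans (ler_normB _ _))//; lra.
  have [p px] := rat_near x _ n0; have [q qy] := rat_near y _ n0.
  exists p => //; exists q => //; exists n => //; rewrite /box' ifT//.
  apply/asboolP => -[x' y'] [/= bx by']; apply: eU; split => /=.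
    exact: (ball_trans _ _ _ _ px ne).
  exact: (ball_trans _ _ _ _ qy ne).
apply: bigcupT_measurable_rat => p; apply: bigcupT_measurable_rat => q.
by apply: bigcupT_measurable => n; rewrite /box'; case: ifPn.
Qed.

Lemma continuous_measurable_plane (h : R * R -> R) : continuous h ->
  measurable_fun (setT : set PR) (h : PR -> measurableTypeR R).
Proof.
move=> /continuousP ch; apply: (measurability _ (RGenOpens.measurableE R)).
move=> _ [_ [a [b ->] <-]]; rewrite setTI; apply: open_measurable_plane.
exact/ch/interval_open.
Qed.

End BorelPlane.

Section TestFunctions.
Context {R : realType}.
Variables (phi : R * R -> R) (w : R * R).
Hypothesis tphi : test_function phi.

Lemma test_function_differentiable z : differentiable phi z.
Proof. by have [/(_ [::])] := tphi. Qed.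

Lemma test_function_continuous : continuous phi.
Proof. by move=> z; exact/differentiable_continuous/test_function_differentiable. Qed.

Lemma continuous_derive_test_function : continuous (fun z => 'D_w phi z).
Proof.
by have [/(_ [:: w]) dphi _] := tphi; move=> z; exact/differentiable_continuous/dphi.
Qed.

(** The derivative is continuous on the compact support and vanishes off it. *)
Lemma derive_test_function_bounded :
  exists2 M : R, 0 <= M & forall z, `|'D_w phi z| <= M.
Proof.
have [_ cphi] := tphi.
have cD : compact ((fun z => 'D_w phi z) @` supp phi).
  apply: continuous_compact => //; apply: continuous_subspaceT.
  exact: continuous_derive_test_function.
have [M [_ MP]] := compact_bounded cD.
exists (`|M| + 1) => [|z]; first by rewrite addr_ge0.
have [zs|zs] := pselect (supp phi z).
  by apply: (MP (`|M| + 1)); [rewrite (le_lt_trans (ler_norm _))// ltrDl|exists z].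
rewrite (_ : 'D_w phi z = 0) ?normr0 ?addr_ge0//.
rewrite -(derive_cst (0 : R) z w); apply: near_eq_derive.
have : nbhs z (~` supp phi).
  by apply: open_nbhs_nbhs; split => //; apply: closed_openC; exact: closed_closure.
apply: filterS => y ys; apply/eqP; apply: contrapT => /negP yn0; apply: ys.
exact: subset_closure.
Qed.

Lemma is_derive_along_line z (t : R) :
  is_derive t 1 (fun s : R => phi (z + s *: w)) ('D_w phi (z + t *: w)).
Proof.
have eq : (fun h : R => h^-1 *: (((fun s : R => phi (z + s *: w)) \o shift t) (h *: 1)
    - phi (z + t *: w))) =
    (fun h => h^-1 *: ((phi \o shift (z + t *: w)) (h *: w) - phi (z + t *: w))).
  apply/funext => h /=; congr (_ *: (phi _ - _)).
  by rewrite /shift/= scalerDl addrCA [h *: 1]mulr1.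
apply: DeriveDef.
  rewrite /derivable eq; apply: diff_derivable; exact: test_function_differentiable.
by rewrite /derive eq.
Qed.

Lemma test_function_lipschitz (M : R) : (forall z, `|'D_w phi z| <= M) ->
  forall z h, 0 <= h -> `|phi (z + h *: w) - phi z| <= M * h.
Proof.
move=> MP z h h0.
have d t := is_derive_along_line z t.
have := @MVT_segment R (fun s : R => phi (z + s *: w))
  (fun s => 'D_w phi (z + s *: w)) 0 h h0 (fun t _ => d t).
case.
  apply: continuous_subspaceT => t; apply/differentiable_continuous/derivable1_diffP.
  by case: (d t).
move=> c _; rewrite scale0r addr0 subr0 => ->.
by rewrite normrM (ger0_norm h0) ler_wpM2r.
Qed.

Lemma test_function_difference_cvg z :
  (fun n : nat => (phi (z + n.+1%:R^-1 *: w) - phi z) * n.+1%:R) @ \oo -->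
  'D_w phi z.
Proof.
have dphi : derivable phi z w by apply: diff_derivable; exact: test_function_differentiable.
have cv : (fun h : R => h^-1 *: ((phi \o shift z) (h *: w) - phi z)) @ 0^' --> 'D_w phi z.
  exact: dphi.
have hn : (fun n : nat => n.+1%:R^-1 : R) @ \oo --> (0 : R)^'.
  move=> A [e /= e0 eA]; have [N _ NP] := near_infty_natSinv_lt (PosNum e0).
  exists N => // n /= Nn; apply: (eA n.+1%:R^-1); rewrite /= ?invr_neq0//.
  rewrite sub0r normrN ger0_norm ?invr_ge0//; exact: NP.
rewrite (_ : (fun _ => _) = (fun h : R => h^-1 *: ((phi \o shift z) (h *: w) - phi z)) \o
  (fun n : nat => n.+1%:R^-1 : R)); first exact: cvg_comp hn cv.
by apply/funext => n /=; rewrite invrK /shift/= (addrC z) mulrC.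
Qed.

End TestFunctions.

(** * Monotonicity away from an axis of symmetry *)

Section UnimodalAlongAxis.
Context {R : realType}.
Implicit Types x w : R * R.

(** Two mirror images lie in the same level sets, and by convexity so does the
    segment between them: along [w] the function [f] decreases with the
    distance to the axis [dot x w = s0]. *)
Lemma unimodal_of_convex_symmetric (f : R * R -> R) w (s0 : R) :
  (forall alpha : R, @convex_set R (R * R)%type [set x | alpha < f x]) ->
  (forall x, f (x + (2 * (s0 - dot x w)) *: w) = f x) ->
  forall x a, `|dot x w + a - s0| <= `|dot x w - s0| -> f x <= f (x + a *: w).
Proof.
move=> cvx sym x a ha.
set b := dot x w - s0 in ha; rewrite addrAC -/b in ha.
have [b0|b0] := eqVneq b 0.
  move: ha; rewrite b0 add0r normr0 normr_le0 => /eqP ->.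
  by rewrite scale0r addr0.
(* the weight l for which x + a w is the barycentre of x and its mirror image *)
pose l := 1 + a / (2 * b).
have l01 : 0 <= l <= 1.
  have : `|1 + a / b| <= 1.
    have -> : 1 + a / b = (b + a) / b by field.
    by rewrite normrM normfV ler_pdivrMr ?normr_gt0// mul1r.
  have -> : l = (1 + (1 + a / b)) / 2 by rewrite /l; field.
  by rewrite ler_norml => /andP[? ?]; apply/andP; split; lra.
have [l0 l1] := andP l01.
rewrite leNgt; apply/negP => lt.
pose t : {i01 R} := Itv01 l0 l1.
pose x' := x + (2 * (s0 - dot x w)) *: w.
have xin : x \in [set y | f (x + a *: w) < f y] by rewrite inE.
have x'in : x' \in [set y | f (x + a *: w) < f y] by rewrite inE /= sym.
have : l *: x + (1 - l) *: x' \in [set y | f (x + a *: w) < f y].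
  exact: (@cvx _ x x' t xin x'in).
rewrite (_ : l *: x + _ = x + a *: w) ?inE/= ?ltxx//.
rewrite scalerDr addrA -scalerDl addrCA subrr addr0 scale1r scalerA.
congr (_ + _ *: _); rewrite -[s0 - _]opprB -/b /l; by field.
Qed.

End UnimodalAlongAxis.

(** * The Radon transform across an axis of symmetry *)

Section RadonOfUnimodal.
Context {R : realType}.
Local Notation mu := (@lebesgue_measure R).
Local Notation PR := (measurableTypeR R * measurableTypeR R)%type.

(** The rotation taking the first basis vector to [w]; [t |-> rot w (s, t)] is
    the parametrization of the line [dot x w = s] in the Radon transform. *)
Definition rot (w : R * R) (z : PR) : PR :=
  z.1 *: (w : R * R) + z.2 *: ((- w.2, w.1) : R * R).

(** A rotation by an angle other than a half turn is a product of three shears,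
    with coefficients [- k], [w.2], [- k] where [k = w.2 / (1 + w.1)] is the
    tangent of the half angle; the condition [0 <= w.1] keeps [1 + w.1] away
    from 0. *)
Lemma measure_preserving_rot (w : R * R) : dot w w = 1 -> 0 <= w.1 ->
  measure_preserving (rot w).
Proof.
move=> w1 w0; pose k := w.2 / (1 + w.1).
have n0 : 1 + w.1 != 0 by rewrite gt_eqF// ltr_wpDr.
have kw1 : k * (1 + w.1) = w.2 by rewrite /k divfK.
have kw2 : k * w.2 = 1 - w.1.
  apply: (mulIf n0); rewrite mulrAC kw1.
  have -> : w.2 * w.2 = 1 - w.1 * w.1 by rewrite -w1 /dot; ring.
  ring.
have e1 (x y : R) : x * w.1 + y * - w.2 =
    x + - k * y + - k * (y + w.2 * (x + - k * y)).
  have -> : x + - k * y + - k * (y + w.2 * (x + - k * y)) =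
    x * (1 - k * w.2) - y * (k * 2 - k * (k * w.2)) by ring.
  rewrite kw2 (_ : k * 2 - k * (1 - w.1) = k * (1 + w.1)); last by ring.
  by rewrite kw1; ring.
have e2 (x y : R) : x * w.2 + y * w.1 = y + w.2 * (x + - k * y).
  have -> : y + w.2 * (x + - k * y) = x * w.2 + y * (1 - k * w.2) by ring.
  by rewrite kw2; ring.
have -> : rot w = (fun z => (z.1 + - k * z.2, z.2)) \o
    ((fun z => (z.1, z.2 + w.2 * z.1)) \o (fun z => (z.1 + - k * z.2, z.2))).
  by apply/funext => -[x y]; congr pair; [exact: e1|exact: e2].
apply: measure_preserving_comp; first exact: measure_preserving_shear1.
apply: measure_preserving_comp; first exact: measure_preserving_shear2.
exact: measure_preserving_shear1.
Qed.

Variables (f : R * R -> R) (g : PR -> R) (w : R * R) (s0 : R).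
Hypothesis f0 : forall x, 0 <= f x.
Hypothesis g0 : forall x, 0 <= g x.
Hypothesis ig : leb2.-integrable setT (EFin \o g).
Hypothesis fg : {ae leb2, forall x, f x = g x}.
Hypothesis w1 : dot w w = 1.
Hypothesis w0 : 0 <= w.1.
Hypothesis f_supp : forall x, f x != 0 -> enorm x < 1.
Hypothesis f_uni : forall x a, `|dot x w + a - s0| <= `|dot x w - s0| ->
  f x <= f (x + a *: w).

Local Notation E := (fun s : measurableTypeR R => \int[mu]_t (f (rot w (s, t)))%:E)%E.
Local Notation Eg := (fun s : measurableTypeR R => \int[mu]_t (g (rot w (s, t)))%:E)%E.

Lemma dot_rot z : dot (rot w z) w = z.1.
Proof.
case: z => s t; rewrite /dot /rot/= /GRing.scale/=.
have -> : (s * w.1 + t * - w.2) * w.1 + (s * w.2 + t * w.1) * w.2 = s * dot w w.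
  by rewrite /dot; ring.
by rewrite w1 mulr1.
Qed.

Lemma dot_rot_rot z : dot (rot w z) (rot w z) = z.1 ^+ 2 + z.2 ^+ 2.
Proof.
case: z => s t; rewrite /dot /rot/= /GRing.scale/=.
rewrite [LHS](_ : _ = (s ^+ 2 + t ^+ 2) * dot w w); last by rewrite /dot; ring.
by rewrite w1 mulr1.
Qed.

Let mg : measurable_fun setT g.
Proof. by apply/measurable_EFinP; exact: measurable_int ig. Qed.

Let mgrot : measurable_fun setT (fun z => (g (rot w z))%:E).
Proof.
apply/measurable_EFinP; apply: measurableT_comp => //.
by have [] := measure_preserving_rot w1 w0.
Qed.

Let E_ge0 s : (0 <= E s)%E.
Proof. by apply: integral_ge0 => t _; rewrite lee_fin. Qed.

Let Eg_ge0 s : (0 <= Eg s)%E.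
Proof. by apply: integral_ge0 => t _; rewrite lee_fin. Qed.

Let mEg : measurable_fun (setT : set (measurableTypeR R)) Eg.
Proof.
have := @measurable_fun_fubini_tonelli_F _ _ (measurableTypeR R) (measurableTypeR R) R mu
  (fun z => (g (rot w z))%:E) mgrot.
by apply => z; rewrite lee_fin.
Qed.

Lemma ae_line_integral_eq : {ae mu, forall s, E s = Eg s}.
Proof.
have [N [mN N0 PN]] := ae_measure_preserving (measure_preserving_rot w1 w0) fg.
have : ae_eq mu setT (mu \o xsection N) (cst 0%E).
  apply/ae_eq_integral_abs => //; first exact: measurable_fun_xsection.
  rewrite -[RHS]N0; apply: eq_integral => s _.
  by rewrite gee0_abs// measure_ge0//; exact: measurable_xsection.
apply: filterS => s /(_ I) /= Ns0.
apply: ae_eq_integral_any; exists (xsection N s); split => //.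
  exact: measurable_xsection.
move=> t /= ft; rewrite /xsection /= inE; apply: PN => /= e; apply: ft.
by rewrite e.
Qed.

Lemma ae_line_integral_fin : {ae mu, forall s, (E s < +oo)%E}.
Proof.
have iEg : mu.-integrable setT Eg.
  apply/integrableP; split => //.
  have -> : (\int[mu]_s `|Eg s| = \int[leb2]_z (g z)%:E)%E.
    rewrite -(ge0_integral_measure_preserving (measure_preserving_rot w1 w0)
      (F := fun z => (g z)%:E)); last 2 first.
    - exact/measurable_EFinP.
    - by move=> z; rewrite lee_fin.
    rewrite /leb2 (fubini_tonelli1 (fun z => (g (rot w z))%:E) mgrot);
      last by move=> z; rewrite lee_fin.
    by apply: eq_integral => s _; rewrite gee0_abs.
  have /integrableP[_] := ig; apply: le_lt_trans.
  rewrite le_eqVlt; apply/orP; left; apply/eqP.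
  by apply: eq_integral => z _ /=; rewrite ger0_norm.
have := integrable_ae measurableT iEg.
move: ae_line_integral_eq; apply: filterS2 => s -> /(_ I).
by rewrite ge0_fin_numE.
Qed.

Lemma line_integral_le s s' : `|s' - s0| <= `|s - s0| -> (E s <= E s')%E.
Proof.
move=> ss; apply: ae_le_integral_any => [t|t|]; try by rewrite lee_fin.
apply: aeW => t; rewrite lee_fin.
have -> : rot w (s', t) = rot w (s, t) + (s' - s) *: w.
  by rewrite /rot/= [RHS]addrAC -scalerDl (addrC s) subrK.
apply: f_uni; rewrite dot_rot/=.
by rewrite addrCA subrr addr0.
Qed.

(** The line integrals are finite almost everywhere and decrease with the
    distance to the axis, so only the one along the axis can be infinite. *)
Lemma line_integral_fin s : s != s0 -> (E s < +oo)%E.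
Proof.
move=> ss0; have d0 : 0 < `|s - s0| by rewrite normr_gt0 subr_eq0.
rewrite ltNge; apply/negP => Eoo.
have [N [mN N0 PN]] := ae_line_integral_fin.
pose J := `]s0, s0 + `|s - s0|[%classic : set (measurableTypeR R).
have JN : J `<=` N.
  move=> s'; rewrite /J/= in_itv/= => /andP[s1 s2]; apply: PN => /=.
  apply/negP; rewrite -leNgt; apply: (le_trans Eoo).
  by apply: line_integral_le; rewrite ger0_norm ?subr_ge0 ?(ltW s1)// lerBlDl ltW.
have : (mu J <= mu N)%E.
  by apply: le_measure => //; rewrite inE//; exact: measurable_itv.
rewrite N0 lebesgue_measure_itv/= lte_fin ltrDl d0 -EFinD lee_fin.
by rewrite addrAC subrr add0r leNgt d0.
Qed.

Lemma line_integral_out s : 1 <= `|s| -> E s = 0%E.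
Proof.
move=> s1; apply: integral0_eq => t _; congr (_%:E); apply/eqP.
apply/negP => /negP /f_supp; apply/negP; rewrite -leNgt.
rewrite -(sqrtr1 R) ler_sqrt; last first.
  by rewrite dot_rot_rot addr_ge0 ?sqr_ge0.
by rewrite dot_rot_rot ler_wpDr ?sqr_ge0// -(real_normK (num_real s)) exprn_ege1.
Qed.

(** In the direction [w] the Radon transform is a unimodal function of the
    distance to the axis, and the total variation of such a function is twice
    its supremum. *)
Lemma line_integral_le_tv s : s != s0 ->
  (2%:E * E s <= tv1 (fun s => radon f s w))%E.
Proof.
move=> ss0.
have d0 : 0 < `|s - s0| by rewrite normr_gt0 subr_eq0.
have rE x : radon f x w = fine (E x) by [].
have Efin x : x != s0 -> E x \is a fin_num.
  by move=> xs0; rewrite ge0_fin_numE// line_integral_fin.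
rewrite -(fineK (Efin _ ss0)) -EFinM.
apply: (@tv1_ge_peak R _ s0 `|s - s0| (1 + `|s0|)) => //.
- exact: fine_ge0.
- by move=> x; rewrite rE fine_ge0.
- move=> x xs0 xs; rewrite rE fine_le ?Efin//; exact: line_integral_le.
- move=> x xM; rewrite rE line_integral_out//.
  by have := ler_normB x s0; lra.
Qed.

Definition slab (h : R) : set PR := [set z | - (h / 2) <= dot z w - s0 < h / 2].

Lemma measurable_dot (u : R * R) : measurable_fun (setT : set PR) (fun z : PR => dot z u).
Proof.
by apply: measurable_funD; apply: measurable_funM.
Qed.

Lemma measurable_slab h : measurable (slab h).
Proof.
rewrite (_ : slab h = (fun z : PR => dot z w) @^-1` `[s0 - h / 2, s0 + h / 2[%classic).
  rewrite -[X in measurable X]setTI.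
  exact: (measurable_dot w measurableT (measurable_itv _)).
apply/seteqP; split => z; rewrite /slab/= in_itv/= => /andP[h1 h2];
  by apply/andP; split; lra.
Qed.

(** By the rotation and Tonelli, the mass of a slab around the axis is an
    integral of values of the Radon transform, each at most half its variation. *)
Lemma slab_integral_le (h : R) : 0 < h ->
  (2%:E * \int[leb2]_z (g z * \1_(slab h) z)%:E <= h%:E * tv1 (fun s => radon f s w))%E.
Proof.
move=> h0; set A := tv1 _.
pose J := `[s0 - h / 2, s0 + h / 2[%classic : set (measurableTypeR R).
have mJ : measurable J by exact: measurable_itv.
have slabJ z : \1_(slab h) (rot w z) = \1_J z.1 :> R.
  rewrite !indicE; congr ((_ : bool)%:R); rewrite /slab /J.
  apply/idP/idP; rewrite !inE /= in_itv/= dot_rot => /andP[h1 h2];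
    by apply/andP; split; lra.
have mgs : measurable_fun setT (fun z => (g z * \1_(slab h) z)%:E).
  apply/measurable_EFinP; apply: measurable_funM => //.
  by apply: measurable_indic; exact: measurable_slab.
have -> : (\int[leb2]_z (g z * \1_(slab h) z)%:E = \int[mu]_s ((\1_J s)%:E * Eg s))%E.
  have gs0 z : (0 <= (g z * \1_(slab h) z)%:E)%E by rewrite lee_fin mulr_ge0.
  have rw := measure_preserving_rot w1 w0.
  rewrite -(ge0_integral_measure_preserving rw mgs gs0).
  rewrite /leb2 (fubini_tonelli1 (fun z => (g (rot w z) * \1_(slab h) (rot w z))%:E)).
  - apply: eq_integral => s _; rewrite /fubini_F -ge0_integralZl//.
    + by apply: eq_integral => t _; rewrite slabJ/= mulrC EFinM.
    + apply: (measurableT_comp mgrot); exact: measurable_pair1.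
    + by move=> t _; rewrite lee_fin.
  - by apply: (measurableT_comp mgs); have [] := rw.
  - by move=> z; exact: gs0.
have AE : {ae mu, forall s : measurableTypeR R, (2%:E * Eg s <= A)%E}.
  have s0ae : {ae mu, forall s : measurableTypeR R, s != s0}.
    exists [set s0]; split => //; first exact: lebesgue_measure_set1.
    by move=> s /= /negP; rewrite negbK => /eqP.
  move: s0ae ae_line_integral_eq; apply: filterS2 => s ss0 <-.
  exact: line_integral_le_tv.
have A0 : (0 <= A)%E.
  pose s1 : R := s0 + 1; apply: (@le_trans _ _ (2%:E * E s1)%E);
    first by rewrite mule_ge0.
  by apply: line_integral_le_tv; rewrite -subr_eq0 /s1 addrAC subrr add0r oner_neq0.
have [->|Aoo] := eqVneq A +oo%E; first by rewrite gt0_muley ?leey// lte_fin.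
have Afin : A \is a fin_num by rewrite ge0_fin_numE// lt_neqAle Aoo leey.
have -> : (h%:E * A = 2%:E * \int[mu]_s (\1_J s * (fine A / 2))%:E)%E.
  rewrite (eq_integral (fun s => ((fine A / 2)%:E * (\1_J s)%:E)%E)); last first.
    by move=> s _; rewrite -EFinM mulrC.
  rewrite ge0_integralZl//; last 2 first.
  - by apply/measurable_EFinP; exact: measurable_indic.
  - by rewrite lee_fin divr_ge0// fine_ge0.
  rewrite integral_indic// setIT /J /= lebesgue_measure_itv/= lte_fin.
  rewrite ltrD2l gtrN ?divr_gt0// -(fineK Afin) -EFinD -!EFinM/=.
  by congr (_%:E); field.
rewrite lee_pmul2l//.
apply: ae_le_integral_any => [s|s|].
- by rewrite mule_ge0// lee_fin.
- by rewrite lee_fin mulr_ge0// divr_ge0// fine_ge0.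
apply: filterS AE => s sA.
rewrite EFinM lee_wpmul2l ?lee_fin//.
by rewrite EFinM fineK// -(@lee_pmul2l _ 2%:E)// muleCA -EFinM divff// mule1.
Qed.

End RadonOfUnimodal.

(** * Variation of f in one direction *)

Section DirectionalVariation.
Context {R : realType}.
Local Notation mu := (@lebesgue_measure R).
Local Notation PR := (measurableTypeR R * measurableTypeR R)%type.

Lemma integrable_mul_bounded (g k : PR -> R) (M : R) :
  leb2.-integrable setT (EFin \o g) -> measurable_fun setT k ->
  (forall z, `|k z| <= M) ->
  leb2.-integrable setT (fun z => (g z * k z)%:E).
Proof.
move=> ig mk kM.
have mg : measurable_fun setT g by apply/measurable_EFinP; exact: measurable_int ig.
apply: (@le_integrable _ _ _ _ _ _ _ (fun z => M%:E * (g z)%:E)%E) => //.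
- by apply/measurable_EFinP; exact: measurable_funM.
- move=> z _; rewrite lee_fin !normrM mulrC ler_wpM2r//.
  exact: le_trans (kM z) (ler_norm _).
- exact: integrableZl.
Qed.

Lemma cauchy_schwarz_unit (x w : R * R) : dot w w = 1 -> enorm x <= 1 ->
  `|dot x w| <= 1.
Proof.
move=> w1 x1.
have x2 : dot x x <= 1.
  have xx : 0 <= dot x x by rewrite /dot -!expr2 addr_ge0 ?sqr_ge0.
  by rewrite -(sqr_sqrtr xx) expr_le1// sqrtr_ge0.
rewrite -(@ler_pXn2r _ 2) ?nnegrE// expr1n real_normK ?num_real//.
have -> : dot x w ^+ 2 = dot x x * dot w w - (x.1 * w.2 - x.2 * w.1) ^+ 2.
  by rewrite /dot; ring.
by rewrite w1 mulr1 lerBlDr (le_trans x2)// lerDl sqr_ge0.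
Qed.

Lemma measure_preserving_add (a : R * R) :
  measure_preserving (fun z : PR => (z : R * R) + a : PR).
Proof. exact: measure_preserving_translation. Qed.

Variables (f : R * R -> R) (g : PR -> R) (w : R * R) (s0 : R).
Hypothesis f0 : forall x, 0 <= f x.
Hypothesis g0 : forall x, 0 <= g x.
Hypothesis ig : leb2.-integrable setT (EFin \o g).
Hypothesis fg : {ae leb2, forall x, f x = g x}.
Hypothesis w1 : dot w w = 1.
Hypothesis w0 : 0 <= w.1.
Hypothesis f_supp : forall x, f x != 0 -> enorm x < 1.
Hypothesis f_uni : forall x a, `|dot x w + a - s0| <= `|dot x w - s0| ->
  f x <= f (x + a *: w).

Local Notation TV := (tv1 (fun s => radon f s w)).

Lemma dot_shift (z : R * R) (a : R) : dot (z + a *: w) w = dot z w + a.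
Proof.
rewrite /dot/= /GRing.scale/=.
rewrite [LHS](_ : _ = z.1 * w.1 + z.2 * w.2 + a * dot w w); last by rewrite /dot; ring.
by rewrite w1 mulr1.
Qed.

(** Moving the translation from [k] to [g] turns the integrand into
    [(f (z - h w) - f z) * k z].  By unimodality the first factor is
    nonnegative on the side [h / 2 <= dot z w - s0] of the axis shifted
    by [h / 2], where [k] is assumed nonnegative, and nonpositive on the other
    side. *)
Lemma integral_increment_ge0 (k : PR -> R) (M h : R) : 0 <= h ->
  measurable_fun setT k -> (forall z, `|k z| <= M) ->
  (forall z, h / 2 <= dot z w - s0 -> 0 <= k z) ->
  (forall z, dot z w - s0 < h / 2 -> k z <= 0) ->
  (0 <= \int[leb2]_z (g z * (k ((z : R * R) + h *: w) - k z))%:E)%E.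
Proof.
move=> h0 mk kM kp kn.
pose a : R * R := h *: w.
have pa := measure_preserving_add a.
have pNa := measure_preserving_add (- a).
have iga : leb2.-integrable setT (EFin \o (g \o (fun z : PR => (z : R * R) - a : PR))).
  exact: integrable_measure_preserving.
have mka : measurable_fun setT (fun z : PR => k ((z : R * R) + a)).
  by apply: (measurableT_comp mk); case: pa.
have i1 := integrable_mul_bounded ig mka (fun z : PR => kM ((z : R * R) + a)).
have i2 := integrable_mul_bounded ig mk kM.
have i3 := integrable_mul_bounded iga mk kM.
have -> : (\int[leb2]_z (g z * (k ((z : R * R) + h *: w) - k z))%:E =
    \int[leb2]_z ((f (z - a) - f z) * k z)%:E)%E.
  under eq_integral do rewrite mulrBr EFinB.
  rewrite integralB//.
  have -> : (\int[leb2]_z (g z * k ((z : R * R) + a))%:E =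
      \int[leb2]_z (g ((z : R * R) - a) * k z)%:E)%E.
    rewrite -(integral_measure_preserving pa (measurable_int _ i3)).
    by apply: eq_integral => z _ /=; rewrite addrK.
  rewrite -integralB//.
  apply: ae_eq_integral_any.
  move: (ae_measure_preserving pNa fg) fg; apply: filterS2 => z /= -> ->.
  by rewrite -EFinB mulrBl.
apply: integral_ge0 => z _; rewrite lee_fin.
have faE : f (z - a) = f (z + (- h) *: w) by rewrite /a scaleNr.
have fz : f z = f ((z + (- h) *: w) + h *: w) by rewrite scaleNr subrK.
have [hz|hz] := leP (h / 2) (dot z w - s0).
  rewrite mulr_ge0 ?kp// subr_ge0 faE; apply: f_uni.
  by rewrite (ger0_norm (x := dot z w - s0)) ?ler_norml; [apply/andP; split|]; lra.
(* f z is compared with f (z - h w) by starting from the latter point *)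
rewrite mulr_le0 ?kn// subr_le0 faE [leRHS]fz; apply: f_uni.
rewrite dot_shift subrK.
by rewrite ler_normr; apply/orP; right; rewrite ?ler_norml; lra.
Qed.

(** Let [sgn] be 1 on the side [h / 2 <= dot z w - s0] and -1 on the other.  As
    [|psi| <= 1], the function [sgn - psi] has the sign required by
    [integral_increment_ge0], so that [psi] may be replaced by [sgn]; and
    [sgn (z + h w) - sgn z] is twice the indicator of a slab of width [h]. *)
Lemma increment_le_tv (psi : PR -> R) (h : R) : 0 < h ->
  measurable_fun setT psi -> (forall z, `|psi z| <= 1) ->
  (\int[leb2]_z (g z * (psi ((z : R * R) + h *: w) - psi z))%:E <= h%:E * TV)%E.
Proof.
move=> h0 mpsi psi1.
pose H : set PR := [set z | h / 2 <= dot z w - s0].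
have mH : measurable H.
  rewrite (_ : H = (fun z : PR => dot z w) @^-1` `[h / 2 + s0, +oo[%classic).
    rewrite -[X in measurable X]setTI.
    exact: (measurable_dot w measurableT (measurable_itv _)).
  by apply/seteqP; split => z; rewrite /H/= in_itv/= andbT lerBrDr.
pose sgn (z : PR) : R := 2 * \1_H z - 1.
have sgnT z : h / 2 <= dot z w - s0 -> sgn z = 1.
  by move=> hz; rewrite /sgn indicE mem_set// mulr1 -[2]/(1 + 1) addrK.
have sgnF z : dot z w - s0 < h / 2 -> sgn z = -1.
  move=> hz; rewrite /sgn indicE memNset ?mulr0 ?sub0r//.
  by rewrite /H/= leNgt => /negP; apply.
have msgn : measurable_fun setT sgn.
  by apply: measurable_funB => //; apply: measurable_funM => //; exact: measurable_indic.
have sgn1 z : `|sgn z| <= 1.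
  have [hz|hz] := leP (h / 2) (dot z w - s0); first by rewrite (sgnT _ hz) normr1.
  by rewrite (sgnF _ hz) normrN1.
have := @integral_increment_ge0 (fun z => sgn z - psi z) 2 h (ltW h0).
have mka (k : PR -> R) : measurable_fun setT k ->
    measurable_fun setT (fun z : PR => k ((z : R * R) + h *: w)).
  by move=> mk; apply: (measurableT_comp mk); case: (measure_preserving_add (h *: w)).
have bd (k : PR -> R) : (forall z, `|k z| <= 1) ->
    forall z : PR, `|k ((z : R * R) + h *: w) - k z| <= 2.
  move=> k1 z; rewrite (le_trans (ler_normB _ _))//.
  by have := k1 z; have := k1 ((z : R * R) + h *: w); lra.
have i1 : leb2.-integrable setT 
    (fun z : PR => (g z * (sgn ((z : R * R) + h *: w) - sgn z))%:E).
  by apply: (integrable_mul_bounded ig _ (bd _ sgn1));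
    apply: measurable_funB => //; exact: mka.
have i2 : leb2.-integrable setT 
    (fun z : PR => (g z * (psi ((z : R * R) + h *: w) - psi z))%:E).
  by apply: (integrable_mul_bounded ig _ (bd _ psi1));
    apply: measurable_funB => //; exact: mka.
have -> : (\int[leb2]_z (g z * (sgn ((z : R * R) + h *: w) - psi ((z : R * R) + h *: w) -
    (sgn z - psi z)))%:E =
  \int[leb2]_z (g z * (sgn ((z : R * R) + h *: w) - sgn z))%:E -
  \int[leb2]_z (g z * (psi ((z : R * R) + h *: w) - psi z))%:E)%E.
  by rewrite -integralB//; apply: eq_integral => z _; rewrite -EFinB; congr (_%:E); ring.
move=> ge0.
apply: (@le_trans _ _ (\int[leb2]_z (g z * (sgn ((z : R * R) + h *: w) - sgn z))%:E)%E).
  rewrite -sube_ge0; last by rewrite (integrable_fin_num _ i1) ?orbT.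
  apply: ge0.
  - exact: measurable_funB.
  - by move=> z; rewrite (le_trans (ler_normB _ _))//; have := sgn1 z; have := psi1 z; lra.
  - by move=> z /sgnT ->; have := psi1 z; rewrite ler_norml; lra.
  - by move=> z /sgnF ->; have := psi1 z; rewrite ler_norml; lra.
apply: le_trans (slab_integral_le f0 g0 ig fg w1 w0 f_supp f_uni h0).
rewrite -ge0_integralZl//; last 2 first.
- apply/measurable_EFinP; apply: measurable_funM.
    by apply/measurable_EFinP; exact: measurable_int ig.
  by apply: measurable_indic; exact: measurable_slab.
- by move=> z _; rewrite lee_fin mulr_ge0.
rewrite le_eqVlt; apply/orP; left; apply/eqP; apply: eq_integral => z _.
rewrite -EFinM mulrCA; congr (_%:E); congr (_ * _).
rewrite indicE; have [zs|zs] := boolP (z \in slab w s0 h).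
  move: zs; rewrite inE /slab/= => /andP[z1 z2].
  rewrite mulr1 (sgnT (z + h *: w)) ?(sgnF z) ?dot_shift//; first by ring.
  by lra.
have {zs} : ~~ (- (h / 2) <= dot z w - s0 < h / 2).
  by apply/negP => zs'; move: zs; rewrite mem_set.
rewrite mulr0 negb_and -ltNge -leNgt => /orP[zs|zs].
  by rewrite (sgnF (z + h *: w)) ?(sgnF z) ?dot_shift ?subrr//; lra.
by rewrite (sgnT (z + h *: w)) ?(sgnT z) ?dot_shift ?subrr//; lra.
Qed.

Variables phi1 phi2 : R * R -> R.
Hypothesis tphi1 : test_function phi1.
Hypothesis tphi2 : test_function phi2.
Hypothesis phi_le1 : forall z, enorm (phi1 z, phi2 z) <= 1.

(** Dominated convergence along the difference quotients with step
    [1 / n.+1]; the domination comes from the Lipschitz bound on the test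
    functions. *)
Lemma directional_derivative_le_tv :
  (\int[leb2]_z (g z * (w.1 * 'D_w phi1 z + w.2 * 'D_w phi2 z))%:E <= TV)%E.
Proof.
pose psi (z : PR) : R := dot (phi1 z, phi2 z) w.
have mpsi : measurable_fun setT psi.
  by apply: measurable_funD; apply: measurable_funM => //;
    apply: continuous_measurable_plane; exact: test_function_continuous.
have psi1 z : `|psi z| <= 1 by exact: cauchy_schwarz_unit.
have [M1 M10 M1P] := derive_test_function_bounded w tphi1.
have [M2 M20 M2P] := derive_test_function_bounded w tphi2.
pose M := `|w.1| * M1 + `|w.2| * M2.
pose F n (z : PR) : \bar R :=
  (g z * ((psi ((z : R * R) + n.+1%:R^-1 *: w) - psi z) * n.+1%:R))%:E.
have mg : measurable_fun setT g by apply/measurable_EFinP; exact: measurable_int ig.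
have mF n : measurable_fun setT (F n).
  apply/measurable_EFinP; apply: measurable_funM => //; apply: measurable_funM => //.
  apply: measurable_funB => //; apply: (measurableT_comp mpsi).
  by case: (measure_preserving_add (n.+1%:R^-1 *: w)).
have mG : measurable_fun setT
    (fun z : PR => (g z * (w.1 * 'D_w phi1 z + w.2 * 'D_w phi2 z))%:E).
  apply/measurable_EFinP; apply: measurable_funM => //.
  by apply: measurable_funD; apply: measurable_funM => //;
    apply: continuous_measurable_plane; exact: continuous_derive_test_function.
have FG : {ae leb2, forall z, setT z -> F ^~ z @ \oo -->
    (g z * (w.1 * 'D_w phi1 z + w.2 * 'D_w phi2 z))%:E}.
  apply: aeW => z _; apply: cvg_EFin; first exact: nearW.
  apply: cvgM; first exact: cvg_cst.
  rewrite (_ : (fun _ => _) = (fun n : nat =>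
    w.1 * ((phi1 ((z : R * R) + n.+1%:R^-1 *: w) - phi1 z) * n.+1%:R) +
    w.2 * ((phi2 ((z : R * R) + n.+1%:R^-1 *: w) - phi2 z) * n.+1%:R))).
    by apply: cvgD; apply: cvgM; (exact: cvg_cst || exact: test_function_difference_cvg).
  by apply/funext => n; rewrite /psi /dot/=; ring.
have FM : {ae leb2, forall z n, setT z -> (`|F n z| <= (g z * M)%:E)%E}.
  apply: aeW => z n _; rewrite lee_fin normrM (ger0_norm (g0 z)) ler_wpM2l//.
  have n0 : 0 <= n.+1%:R^-1 :> R by rewrite invr_ge0.
  rewrite normrM (ger0_norm (x := n.+1%:R))// -ler_pdivlMr ?ltr0n//.
  rewrite /psi /dot/= (_ : _ - _ =
    w.1 * (phi1 ((z : R * R) + n.+1%:R^-1 *: w) - phi1 z) +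
    w.2 * (phi2 ((z : R * R) + n.+1%:R^-1 *: w) - phi2 z)); last by ring.
  rewrite (le_trans (ler_normD _ _))// !normrM /M mulrDl -!mulrA lerD// ler_wpM2l//.
    exact: test_function_lipschitz.
  exact: test_function_lipschitz.
have iM : leb2.-integrable setT (fun z => (g z * M)%:E).
  by apply: (@integrable_mul_bounded _ _ `|M| ig).
have [_ _ cvF] := dominated_convergence measurableT mF mG FG iM FM.
apply: (cvge_le _ cvF); apply: nearW => n /=.
pose h : R := n.+1%:R^-1.
have mpsih : measurable_fun setT (fun z : PR => psi ((z : R * R) + h *: w) - psi z).
  apply: measurable_funB => //; apply: (measurableT_comp mpsi).
  by case: (measure_preserving_add (h *: w)).
have psih2 z : `|psi ((z : R * R) + h *: w) - psi z| <= 2.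
  rewrite (le_trans (ler_normB _ _))//.
  by have := psi1 z; have := psi1 ((z : R * R) + h *: w); lra.
have -> : (\int[leb2]_z F n z = n.+1%:R%:E *
    \int[leb2]_z (g z * (psi ((z : R * R) + h *: w) - psi z))%:E)%E.
  rewrite -integralZl//; last exact: (integrable_mul_bounded ig mpsih psih2).
  by apply: eq_integral => z _; rewrite -EFinM; congr (_%:E); rewrite /F /h; ring.
apply: (@le_trans _ _ (n.+1%:R%:E * (h%:E * TV))%E).
  by rewrite lee_wpmul2l ?lee_fin//; apply: increment_le_tv; rewrite // invr_gt0.
by rewrite muleA -EFinM /h divff// mul1e.
Qed.

End DirectionalVariation.

(** * Variation in an orthonormal frame *)

Section OrthonormalFrames.
Context {R : realType}.
Implicit Types u v w x q : R * R.

Lemma circle_dot u : circle u -> dot u u = 1.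
Proof.
move=> u1; have uu : 0 <= dot u u by rewrite /dot -!expr2 addr_ge0 ?sqr_ge0.
by rewrite -(sqr_sqrtr uu) [Num.sqrt _]u1 expr1n.
Qed.

(** A real square matrix with orthonormal rows has orthonormal columns. *)
Lemma orthonormal_frame u v : dot u u = 1 -> dot v v = 1 -> dot u v = 0 ->
  [/\ u.1 * u.1 + v.1 * v.1 = 1, u.1 * u.2 + v.1 * v.2 = 0
    & u.2 * u.2 + v.2 * v.2 = 1].
Proof.
case: u => u1 u2; case: v => v1 v2; rewrite /dot/= => uu vv uv.
pose c := u1 * v2 - u2 * v1.
have c2 : c ^+ 2 = 1.
  have -> : c ^+ 2 = (u1 * u1 + u2 * u2) * (v1 * v1 + v2 * v2) - (u1 * v1 + u2 * v2) ^+ 2.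
    by rewrite /c; ring.
  by rewrite uu vv uv expr0n/= subr0 mulr1.
have v1E : v1 = - c * u2.
  have -> : - c * u2 = v1 * (u1 * u1 + u2 * u2) - u1 * (u1 * v1 + u2 * v2).
    by rewrite /c; ring.
  by rewrite uu uv mulr1 mulr0 subr0.
have v2E : v2 = c * u1.
  have -> : c * u1 = v2 * (u1 * u1 + u2 * u2) - u2 * (u1 * v1 + u2 * v2).
    by rewrite /c; ring.
  by rewrite uu uv mulr1 mulr0 subr0.
split.
- have -> : v1 * v1 = c ^+ 2 * (u2 * u2) by rewrite v1E; ring.
  by rewrite c2 mul1r.
- have -> : v1 * v2 = - (c ^+ 2 * (u1 * u2)) by rewrite {1}v1E {1}v2E; ring.
  by rewrite c2 mul1r subrr.
- have -> : v2 * v2 = c ^+ 2 * (u1 * u1) by rewrite v2E; ring.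
  by rewrite c2 mul1r addrC.
Qed.

(** The point [q] matters only through [dot q u], so that the two axes of
    symmetry need not be given with a common point. *)
Lemma reflection_orthogonal u v q x :
  dot u u = 1 -> dot v v = 1 -> dot u v = 0 ->
  reflection q v x = x + (2 * (dot q u - dot x u)) *: u.
Proof.
move=> uu vv uv; have [e11 e12 e22] := orthonormal_frame uu vv uv.
case: u uu uv e11 e12 e22 => u1 u2; case: v vv => v1 v2.
case: q => q1 q2; case: x => x1 x2; rewrite /reflection /dot/= => vv uu uv e11 e12 e22.
congr pair; rewrite /= /GRing.scale/=; apply/eqP; rewrite -subr_eq0; apply/eqP.
- have -> : q1 + 2 * ((x1 - q1) * v1 + (x2 - q2) * v2) * v1 - (x1 - q1) -
    (x1 + 2 * (q1 * u1 + q2 * u2 - (x1 * u1 + x2 * u2)) * u1) =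
    2 * ((x1 - q1) * (u1 * u1 + v1 * v1 - 1) + (x2 - q2) * (u1 * u2 + v1 * v2)) by ring.
  by rewrite e11 e12 subrr !mulr0 addr0 mulr0.
- have -> : q2 + 2 * ((x1 - q1) * v1 + (x2 - q2) * v2) * v2 - (x2 - q2) -
    (x2 + 2 * (q1 * u1 + q2 * u2 - (x1 * u1 + x2 * u2)) * u2) =
    2 * ((x2 - q2) * (u2 * u2 + v2 * v2 - 1) + (x1 - q1) * (u1 * u2 + v1 * v2)) by ring.
  by rewrite e22 e12 subrr !mulr0 addr0 mulr0.
Qed.

Lemma derive_coord (phi : R * R -> R) w z : differentiable phi z ->
  'D_w phi z = w.1 * 'D_((1, 0) : R * R) phi z + w.2 * 'D_((0, 1) : R * R) phi z.
Proof.
move=> dphi; rewrite !deriveE//.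
have {1}-> : w = w.1 *: ((1, 0) : R * R) + w.2 *: ((0, 1) : R * R).
  by case: w => a b; congr pair; rewrite /= /GRing.scale/= ?mulr0 ?mulr1 ?add0r ?addr0.
by rewrite linearD !linearZ.
Qed.

End OrthonormalFrames.

Section DirectionalBound.
Context {R : realType}.
Local Notation PR := (measurableTypeR R * measurableTypeR R)%type.
Variables (f : R * R -> R) (g : PR -> R).
Hypothesis f0 : forall x, 0 <= f x.
Hypothesis g0 : forall x, 0 <= g x.
Hypothesis ig : leb2.-integrable setT (EFin \o g).
Hypothesis fg : {ae leb2, forall x, f x = g x}.
Hypothesis f_supp : forall x, f x != 0 -> enorm x < 1.
Hypothesis f_cvx : forall alpha : R, @convex_set R (R * R)%type [set x | alpha < f x].
Variables phi1 phi2 : R * R -> R.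
Hypothesis tphi1 : test_function phi1.
Hypothesis tphi2 : test_function phi2.
Hypothesis phi_le1 : forall z, enorm (phi1 z, phi2 z) <= 1.

(** The restriction [0 <= w.1] disappears because everything here is unchanged
    when [w] and [s0] are replaced by their opposites. *)
Lemma directional_derivative_le_rtv (w : R * R) (s0 : R) : dot w w = 1 ->
  (forall x, f (x + (2 * (s0 - dot x w)) *: w) = f x) ->
  (\int[leb2]_z (g z * (w.1 * 'D_w phi1 z + w.2 * 'D_w phi2 z))%:E <= rtv (radon f))%E.
Proof.
have le_rtv (u : R * R) : dot u u = 1 ->
    (tv1 (fun s => radon f s u) <= rtv (radon f))%E.
  by move=> uu; apply: ereal_sup_ubound; exists u => //;
    rewrite /circle/= /enorm uu sqrtr1.
move=> w1 sym.
have [w0|w0] := leP 0 w.1.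
  apply: le_trans (le_rtv _ w1).
  by apply: (directional_derivative_le_tv f0 g0 ig fg w1 w0 f_supp
    (unimodal_of_convex_symmetric f_cvx sym)).
have dotN x : dot x (- w) = - dot x w by rewrite /dot/=; ring.
have Nw1 : dot (- w) (- w) = 1 by rewrite -w1 /dot/=; ring.
have Nw0 : 0 <= (- w).1 by rewrite /= oppr_ge0 ltW.
have Nsym x : f (x + (2 * (- s0 - dot x (- w))) *: - w) = f x.
  rewrite -[RHS]sym dotN scalerN -scaleNr; congr (f (_ + _ *: _)); ring.
apply: le_trans (le_rtv _ Nw1).
have DN phi z : test_function phi -> 'D_(- w) phi z = - 'D_w phi z.
  by move=> tphi; rewrite !deriveE ?linearN//; exact: test_function_differentiable.
have dE : (fun z : PR => (g z * (w.1 * 'D_w phi1 z + w.2 * 'D_w phi2 z))%:E) =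
    (fun z : PR => (g z * ((- w).1 * 'D_(- w) phi1 z + (- w).2 * 'D_(- w) phi2 z))%:E).
  by apply/funext => z; rewrite !DN// !mulrNN.
rewrite dE.
exact: (directional_derivative_le_tv f0 g0 ig fg Nw1 Nw0 f_supp
  (unimodal_of_convex_symmetric f_cvx Nsym) tphi1 tphi2 phi_le1).
Qed.

End DirectionalBound.

Local Notation plane R := (measurableTypeR R * measurableTypeR R)%type.

Theorem theorem6 (R : realType) :
  exists C : R, 0 < C /\
    forall f : R * R -> R,
      (forall x, 0 <= f x) ->
      lebesgue_integrable2 f ->
      supp f `<=` [set x | enorm x < 1] ->
      (forall alpha : R, @convex_set R (R * R)%type [set x | alpha < f x]) ->
      (exists p u q v : R * R,
        [/\ symmetry_axis f p u, symmetry_axis f q v & dot u v = 0]) ->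
      (C%:E * tv2 f <= rtv (radon f))%E.
Proof.
exists 2^-1; split; first by rewrite invr_gt0.
move=> f f0 [g' ig' fg'] fsupp fcvx [p [u [q [v [[uc fu] [vc fv] uv]]]]].
have uu := circle_dot uc; have vv := circle_dot vc.
have vu : dot v u = 0 by rewrite -uv /dot; ring.
pose g : plane R -> R := fun z => `|g' z|.
have g0 z : 0 <= g z by exact: normr_ge0.
have ig : leb2.-integrable setT (EFin \o g).
  by have := integrable_abse ig'; apply: eq_integrable.
have fg : {ae leb2, forall x, f x = g x}.
  have [N [mN N0 PN]] := fg'; exists N; split => // z /= fz; apply: PN => /= e.
  by apply: fz; rewrite /g -e ger0_norm.
have f_supp x : f x != 0 -> enorm x < 1.
  by move=> fx; apply: fsupp; exact: subset_closure.
have symu x : f (x + (2 * (dot q u - dot x u)) *: u) = f x.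
  by rewrite -(reflection_orthogonal q x uu vv uv) fv.
have symv x : f (x + (2 * (dot p v - dot x v)) *: v) = f x.
  by rewrite -(reflection_orthogonal p x vv uu vu) fu.
have [e11 e12 e22] := orthonormal_frame uu vv uv.
have div_frame (a b a' b' : R) : a + b =
    u.1 * (u.1 * a + u.2 * b') + u.2 * (u.1 * a' + u.2 * b) +
    (v.1 * (v.1 * a + v.2 * b') + v.2 * (v.1 * a' + v.2 * b)).
  rewrite [RHS](_ : _ = (u.1 * u.1 + v.1 * v.1) * a +
    (u.1 * u.2 + v.1 * v.2) * (a' + b') + (u.2 * u.2 + v.2 * v.2) * b); last by ring.
  by rewrite e11 e12 e22 !mul1r mul0r addr0.
suff tv2_le : (tv2 f <= rtv (radon f) + rtv (radon f))%E.
  apply: (@le_trans _ _ ((2^-1)%:E * (rtv (radon f) + rtv (radon f)))%E).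
    by rewrite lee_wpmul2l// lee_fin invr_ge0.
  case: (rtv _) => [r| |]; last 2 first.
  - by rewrite leey.
  - by rewrite /= gt0_muleNy// lte_fin invr_gt0.
  by rewrite -EFinD -EFinM lee_fin; lra.
apply: ge_ereal_sup => _ [phi [tphi1 tphi2 phi_le1] <-].
pose d w (z : plane R) : R :=
  w.1 * 'D_w (fun x => (phi x).1) z + w.2 * 'D_w (fun x => (phi x).2) z.
have phi_le1' z : enorm ((phi z).1, (phi z).2) <= 1 by rewrite -surjective_pairing.
have bound w s0 := @directional_derivative_le_rtv R f g f0 g0 ig fg f_supp fcvx
  _ _ tphi1 tphi2 phi_le1' w s0.
have id_ w : leb2.-integrable setT (fun z => (g z * d w z)%:E).
  have [M1 M10 M1P] := derive_test_function_bounded w tphi1.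
  have [M2 M20 M2P] := derive_test_function_bounded w tphi2.
  apply: (@integrable_mul_bounded _ _ _ (`|w.1| * M1 + `|w.2| * M2) ig).
    by apply: measurable_funD; apply: measurable_funM => //;
      apply: continuous_measurable_plane; exact: continuous_derive_test_function.
  by move=> z; rewrite (le_trans (ler_normD _ _))// !normrM lerD// ler_wpM2l.
(* the divergence computed in the orthonormal basis formed by the axes *)
rewrite (_ : integral _ _ _ =
  \int[leb2]_z (g z * d u z)%:E + \int[leb2]_z (g z * d v z)%:E)%E.
  by apply: leeD; [exact: bound symu|exact: bound symv].
rewrite -integralD//; apply: ae_eq_integral_any.
have [N [mN N0 PN]] := fg; exists N; split => // z /= fz; apply: PN => /= e.
apply: fz; rewrite e -EFinD -mulrDr; congr (_ * _)%:E.
rewrite /div2 /d !(derive_coord u) ?(derive_coord v);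
  try exact: test_function_differentiable.
exact: div_frame.
Qed.
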